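(* Let $r\ge 2$ and $t\ge 1$ be integers and let $T$ be an acyclic $r$-uniform hypergraph. Then $$\left\lceil \frac{R^r(T,t)-1}{r-1}\right\rceil+1\le \chi(T,t).$$
   Context: Hypergraphs $H=(V,E)$ are finite: $V$ is a nonempty finite set of vertices and $E$ is a set of subsets of $V$ (edges), each of size at least $2$; $H$ is $r$-uniform if all edges have size $r$. The edge set of a hypergraph being colored is allowed to be empty. A $k$-coloring $c:V\to\{1,\dots,k\}$ is proper if no edge is monochromatic; the chromatic number $\chi(H)$ is the least $m\ge 1$ such that $H$ has a proper $m$-coloring, and then $H$ is called $m$-chromatic. A cycle is a sequence of $k\ge 2$ distinct vertices $v_1,\dots,v_k$ and $k$ distinct edges $e_1,\dots,e_k$ with $v_i,v_{i+1}\in e_i$ (indices mod $k$); in particular two edges meeting in at least two vertices form a $2$-cycle. A hypergraph is acyclic if it contains no cycles. A $t$-edge-coloring of $H=(V,E)$ is a partition $E=E_1\cup\dots\cup E_t$ into $t$ pairwise disjoint (possibly empty) color classes. A monochromatic copy of $T$ is a (not necessarily induced) subhypergraph isomorphic to $T$ all of whose edges lie in one class $E_i$. For an acyclic $r$-uniform hypergraph $T$, the ($t$-color) chromatic Ramsey number $\chi(T,t)$ is the smallest positive integer $m$ such that under any $t$-edge-coloring of any $m$-chromatic $r$-uniform hypergraph there is a monochromatic copy of $T$ (such an $m$ exists for every acyclic $T$). $R^r(T,t)$ is the $t$-color Ramsey number of $T$: the smallest integer $n$ such that under any $t$-edge-coloring of the complete $r$-uniform hypergraph $K_n^r$ on $n$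 vertices there is a monochromatic copy of $T$. *)

(* Defs.v *)
From mathcomp Require Import all_boot all_order all_algebra.

Set Implicit Arguments.
Unset Strict Implicit.
Unset Printing Implicit Defensive.

Record hypergraph := Hypergraph {
  vertices :> finType;
  edges : {set {set vertices}};
  vertices_gt0 : 0 < #|vertices|;
  edges_gt1 : forall e, e \in edges -> 1 < #|e|
}.

Definition uniform (r : nat) (H : hypergraph) : Prop :=
  forall e, e \in edges H -> #|e| = r.

(* ordS is the cyclic successor on 'I_k, so the last edge contains the last
   and the first vertex. *)
Definition is_cycle (H : hypergraph) (k : nat)
    (v : 'I_k -> H) (e : 'I_k -> {set H}) : Prop :=
  [/\ 1 < k, injective v, injective e &
      forall i, [/\ e i \in edges H, v i \in e i & v (ordS i) \in e i]].

Definition acyclic (H : hypergraph) : Prop :=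
  forall k (v : 'I_k -> H) (e : 'I_k -> {set H}), ~ is_cycle v e.

Definition is_least (P : nat -> Prop) (m : nat) : Prop :=
  P m /\ forall k, P k -> m <= k.

Definition monochromatic (V : finType) (k : nat) (c : V -> 'I_k) (e : {set V})
    : Prop :=
  exists a, forall x, x \in e -> c x = a.

Definition proper_coloring (H : hypergraph) (k : nat) (c : H -> 'I_k) : Prop :=
  forall e, e \in edges H -> ~ monochromatic c e.

Definition chromatic (m : nat) (H : hypergraph) : Prop :=
  is_least (fun k => 0 < k /\ exists c : H -> 'I_k, proper_coloring c) m.

Definition edge_coloring (V : finType) (E : {set {set V}}) (t : nat)
    (C : 'I_t -> {set {set V}}) : Prop :=
  \bigcup_i C i = E /\ forall i j, i != j -> [disjoint C i & C j].

(* f is an isomorphism from T onto the hypergraph with vertex set W and edge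
   set F; here W may contain vertices lying on no edge of F. *)
Definition is_copy (T : hypergraph) (V : finType)
    (W : {set V}) (F : {set {set V}}) : Prop :=
  exists f : T -> V,
    [/\ injective f, f @: [set: T] = W & [set f @: e | e : {set T} in edges T] = F].

Definition monochromatic_copy (T : hypergraph) (V : finType) (t : nat)
    (C : 'I_t -> {set {set V}}) : Prop :=
  exists W F i, is_copy T W F /\ F \subset C i.

Definition chromatic_ramsey_number (r : nat) (T : hypergraph) (t m : nat)
    : Prop :=
  is_least (fun k => 0 < k /\
    forall H : hypergraph, uniform r H -> chromatic k H ->
    forall C : 'I_t -> {set {set H}}, edge_coloring (edges H) C ->
    monochromatic_copy T C) m.

Definition complete_edges (r n : nat) : {set {set 'I_n}} :=
  [set e : {set 'I_n} | #|e| == r].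

(* n = 0 never qualifies, since T has a vertex. *)
Definition ramsey_number (r : nat) (T : hypergraph) (t n : nat) : Prop :=
  is_least (fun k =>
    forall C : 'I_t -> {set {set 'I_k}}, edge_coloring (complete_edges r k) C ->
    monochromatic_copy T C) n.

(* Main.v *)
Require Import Defs.
From mathcomp Require Import all_boot all_order all_algebra.

Import GRing.Theory Num.Theory.

(** The complete [r]-uniform hypergraph on [(m - 1)(r - 1) + 1] vertices is
    [m]-chromatic, because its proper colorings are exactly the maps all of
    whose classes have at most [r - 1] vertices: [m] classes of that size cover
    the vertex set, while [m - 1] of them fall one vertex short
    ([chromatic_complete]).  Taking [m] to be the chromatic Ramsey number of [T],
    every [t]-edge-coloring of this complete hypergraph contains a monochromatic
    copy of [T], so the Ramsey number satisfies [R <= (m - 1)(r - 1) + 1].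
    Dividing by [r - 1] gives [(R - 1)/(r - 1) <= m - 1], and the right-hand side
    is an integer, so the bound survives rounding up. *)

Lemma complete_edges_gt1 (r n : nat) (e : {set 'I_n}) :
  1 < r -> e \in complete_edges r n -> 1 < #|e|.
Proof. by move=> r_gt1; rewrite inE => /eqP->. Qed.

Lemma card_ord_gt0 (n : nat) : 0 < n -> 0 < #|'I_n|.
Proof. by rewrite card_ord. Qed.

Definition complete_hypergraph (r n : nat) (r_gt1 : 1 < r) (n_gt0 : 0 < n)
    : hypergraph :=
  @Hypergraph 'I_n (complete_edges r n) (card_ord_gt0 n n_gt0)
    (fun e => complete_edges_gt1 r n e r_gt1).

Lemma complete_uniform (r n : nat) (r_gt1 : 1 < r) (n_gt0 : 0 < n) :
  uniform r (complete_hypergraph r n r_gt1 n_gt0).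
Proof. by move=> e; rewrite inE => /eqP. Qed.

(** A class with [r] or more vertices contains an [r]-set, which is an edge of
    the complete hypergraph; conversely a monochromatic edge lies in a class. *)
Lemma proper_completeP (r n k : nat) (r_gt1 : 1 < r) (n_gt0 : 0 < n)
    (c : 'I_n -> 'I_k) :
  proper_coloring (H := complete_hypergraph r n r_gt1 n_gt0) c <->
  forall a, #|[set x | c x == a]| < r.
Proof.
split=> [proper_c a | small_c e].
  rewrite ltnNge; apply/negP => /card_geqP[s [uniq_s size_s sub_s]].
  apply: (proper_c [set x in s]).
    by rewrite inE cardsE (card_uniqP uniq_s) size_s.
  by exists a => x; rewrite inE => /sub_s; rewrite inE => /eqP.
rewrite inE => /eqP card_e [a mono_e].
have := small_c a; rewrite ltnNge -{1}card_e subset_leq_card //.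
by apply/subsetP => x /mono_e; rewrite inE => ->.
Qed.

(** Two elements of a fiber of the quotient map that leave the same remainder
    are equal, so a fiber embeds in the [d] possible remainders. *)
Lemma card_divn_fiber (n d q : nat) :
  0 < d -> #|[set x : 'I_n | x %/ d == q]| <= d.
Proof.
move=> d_gt0; pose rem (x : 'I_n) := Ordinal (ltn_pmod x d_gt0).
rewrite -(card_in_imset (f := rem)); first by rewrite -[leqRHS]card_ord max_card.
move=> x y; rewrite !inE => /eqP xq /eqP yq [eq_rem].
by apply: val_inj; rewrite /= (divn_eq x d) (divn_eq y d) xq yq eq_rem.
Qed.

Lemma card_fibers_leq (n k d : nat) (c : 'I_n -> 'I_k) :
  (forall a, #|[set x | c x == a]| <= d) -> n <= k * d.
Proof.
move=> small_c; rewrite -[n in n <= _]card_ord -sum1_card.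
rewrite (partition_big c xpredT) //= -[k in k * d]card_ord -sum_nat_const.
by apply: leq_sum => a _; rewrite sum1dep_card small_c.
Qed.

(** Blocks of [r - 1] consecutive vertices give a proper coloring with [m]
    colors; the last block is a single vertex, which is what defeats [m - 1]
    colors. *)
Lemma chromatic_complete (r m : nat) (r_gt1 : 1 < r)
    (n_gt0 : 0 < (m.-1 * r.-1).+1) :
  0 < m -> chromatic m (complete_hypergraph r (m.-1 * r.-1).+1 r_gt1 n_gt0).
Proof.
move=> m_gt0.
have d_gt0 : 0 < r.-1 by rewrite -subn1 subn_gt0.
have rE : r = r.-1.+1 by rewrite prednK // ltnW.
split.
  split=> //.
  have block_lt (x : 'I_(m.-1 * r.-1).+1) : x %/ r.-1 < m.
    rewrite ltn_divLR //; apply: leq_trans (ltn_ord x) _.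
    by rewrite ltn_pmul2r // ltn_predL.
  exists (fun x => Ordinal (block_lt x)).
  by apply/proper_completeP => a; rewrite [ltnRHS]rE ltnS; exact: card_divn_fiber.
move=> k [_ [c /proper_completeP small_c]].
have le_n : (m.-1 * r.-1).+1 <= k * r.-1.
  by apply: card_fibers_leq => a; rewrite -ltnS -rE; exact: small_c.
by rewrite -(prednK m_gt0) -(ltn_pmul2r d_gt0).
Qed.

Lemma ramsey_number_leq (r t : nat) (T : hypergraph) (R chi : nat) :
  1 < r -> ramsey_number r T t R -> chromatic_ramsey_number r T t chi ->
  R <= (chi.-1 * r.-1).+1.
Proof.
move=> r_gt1 [_ least_R] [[chi_gt0 copies] _]; apply: least_R.
exact: copies (complete_uniform _ _ r_gt1 (ltn0Sn _))
  (chromatic_complete _ _ _ _ chi_gt0).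
Qed.

Theorem proposition3 (r t : nat) (T : hypergraph) (R chi : nat) :
  2 <= r -> 1 <= t -> uniform r T -> acyclic T ->
  ramsey_number r T t R -> chromatic_ramsey_number r T t chi ->
  (Num.ceil ((R%:R - 1) / (r%:R - 1) : rat) + 1 <= chi%:Z)%R.
Proof.
move=> r_gt1 _ _ _ ramsey_R ramsey_chi.
have := ramsey_number_leq _ _ _ _ _ r_gt1 ramsey_R ramsey_chi.
case: ramsey_chi => [[chi_gt0 _] _].
case: r r_gt1 ramsey_R => // d; rewrite ltnS => d_gt0 _.
case: chi chi_gt0 => // m _ /= R_leq.
have -> : (d.+1%:R - 1 = d%:R :> rat)%R by rewrite -natr1 addrK.
rewrite -[m.+1]addn1 PoszD lerD2r ceil_le_int ler_pdivrMr ?ltr0n //.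
by rewrite lerBlDr -natrM natr1 ler_nat.
Qed.
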